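(* Let $K\subset\mathbb{R}^2$ be a convex body (compact convex set) and write $r=r(K)$, $w=w(K)$, $D=D(K)$, $R=R(K)$. Then \[ w \ \ge\ 2D\sqrt{1-\left(\frac{D}{2R}\right)^2}\;\cos\!\left[\arccos\!\left(\frac{D}{2(D-r)}\right)+\arccos\!\left(\frac{D}{2R}\right)-\arcsin\!\left(\frac{r}{D-r}\right)\right]. \]
   Context: For a convex body $K\subset\mathbb{R}^n$: the diameter $D(K)$ is the largest distance between two points of $K$; the width $w(K)$ is the smallest distance between two distinct parallel supporting hyperplanes (lines in the plane) of $K$; the inradius $r(K)$ is the radius of a largest Euclidean ball contained in $K$; the circumradius $R(K)$ is the radius of the smallest Euclidean ball containing $K$. *)

(* Defs.v *)
From Stdlib Require Import Reals Lra.
From Coquelicot Require Import Coquelicot.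
Open Scope R_scope.

Definition pt := (R * R)%type.

Definition dist2 (p q : pt) : R :=
  sqrt ((fst p - fst q) ^ 2 + (snd p - snd q) ^ 2).

Definition dot2 (p q : pt) : R := fst p * fst q + snd p * snd q.

Definition convex2 (K : pt -> Prop) : Prop :=
  forall p q t, K p -> K q -> 0 <= t <= 1 ->
    K ((1 - t) * fst p + t * fst q, (1 - t) * snd p + t * snd q).

Definition closed2 (K : pt -> Prop) : Prop :=
  forall p, (forall eps, 0 < eps -> exists q, K q /\ dist2 p q < eps) -> K p.

Definition bounded2 (K : pt -> Prop) : Prop :=
  exists M, forall p, K p -> dist2 p (0, 0) <= M.

Definition has_interior2 (K : pt -> Prop) : Prop :=
  exists c rho, 0 < rho /\ forall p, dist2 p c < rho -> K p.

Definition convex_body2 (K : pt -> Prop) : Prop :=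
  convex2 K /\ closed2 K /\ bounded2 K /\ has_interior2 K.

Definition diameter (K : pt -> Prop) : R :=
  real (Lub_Rbar (fun d => exists p q, K p /\ K q /\ d = dist2 p q)).

Definition support (K : pt -> Prop) (u : pt) : R :=
  real (Lub_Rbar (fun s => exists x, K x /\ s = dot2 x u)).

(* Width: the distance between the two parallel supporting lines orthogonal to
   the unit vector u is h_K(u) + h_K(-u); the width is its minimum over u. *)
Definition width (K : pt -> Prop) : R :=
  real (Glb_Rbar (fun w => exists u : pt, fst u ^ 2 + snd u ^ 2 = 1 /\
          w = support K u + support K (- fst u, - snd u))).

Definition inradius (K : pt -> Prop) : R :=
  real (Lub_Rbar (fun rho => 0 <= rho /\
          exists c, forall p, dist2 p c <= rho -> K p)).

Definition circumradius (K : pt -> Prop) : R :=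
  real (Glb_Rbar (fun rho => 0 <= rho /\
          exists c, forall p, K p -> dist2 p c <= rho)).

(* Main.v *)
Require Import Defs.
From Stdlib Require Import Reals Lra Lia Psatz Classical IndefiniteDescription Rtopology Rgeom.
From Coquelicot Require Import Coquelicot.
Open Scope R_scope.

(** If [D < 2 Rc], the points of [K] on the circumcircle include the vertices
    of a non-obtuse triangle inscribed in it: a longest chord between such
    points, and a third one on the other side of the center.  Put
    [rho = D - r]; the incenter [c] is within [rho] of every point of [K], since
    [K] contains the antipodal point of the incircle.  With
    [al = acos (D / 2Rc)], [be = acos (D / 2rho)], [ga = asin (r / rho)] and
    [de = al + be - ga] the bound is [2Rc sin (2al) cos de].

    Fix a strip containing the triangle and the incircle, and normalize it to
    be horizontal with the lowest vertex at the origin, the highest vertex [B] to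
    its left and the third vertex [A] to its right.  Triangle angles lie between
    [2al] and [PI/2 - al].  If [de < 0], the diameter [2r] of the incircle is
    already large enough; if [de > al], an altitude is.  Otherwise, either [B] is
    high enough, or the incenter, which lies in the intersection of the discs of
    radius [rho] about [A] and [B], cannot be lower than the lower corner of
    this lens, and then the top of the incircle is high enough. *)

(** * Trigonometry *)

Lemma cos_le_of_abs_le (x y : R) : Rabs x <= y -> y <= PI -> cos y <= cos x.
Proof.
  intros Hx Hy; pose proof (Rabs_pos x); pose proof PI_RGT_0.
  assert (E : cos x = cos (Rabs x)).
  { unfold Rabs; destruct (Rcase_abs x); [now rewrite cos_neg | reflexivity]. }
  rewrite E; apply cos_decr_1; lra.
Qed.

Lemma sin_le_sin_of_between (t x : R) :
  - (PI / 2) <= t -> t <= x -> x <= PI - t -> sin t <= sin x.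
Proof.
  intros H1 H2 H3; rewrite <- (cos_shift t), <- (cos_shift x).
  apply cos_le_of_abs_le; [apply Rabs_le; lra | lra].
Qed.

Lemma two_cos_sin (u v : R) : 2 * (cos u * sin v) = sin (u + v) - sin (u - v).
Proof. rewrite sin_minus, sin_plus; ring. Qed.

Lemma two_cos_cos (u v : R) : 2 * (cos u * cos v) = cos (u + v) + cos (u - v).
Proof. rewrite cos_minus, cos_plus; ring. Qed.

Lemma two_sin_sin (u v : R) : 2 * (sin u * sin v) = cos (u - v) - cos (u + v).
Proof. rewrite cos_minus, cos_plus; ring. Qed.

(** With [p] and [q] the sides from the origin to [B] and [A], the left-hand sides are the
    coordinates of the vector from [B] to [A]. By the law of sines its length is
    [2 Rc sin (th + th2)], and it descends at slope angle [th2 - om - th]. *)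
Lemma chord_coordinates (Rc th th2 om : R) :
  let p := 2 * Rc * cos (th + om) in
  let q := 2 * Rc * cos (th2 - om) in
  p * sin th + q * sin th2 = 2 * Rc * sin (th + th2) * cos (th2 - om - th) /\
  q * cos th2 - p * cos th = - (2 * Rc * sin (th + th2) * sin (th2 - om - th)).
Proof.
  intros p q; unfold p, q; split.
  - pose proof (two_cos_sin (th + om) th) as E1.
    pose proof (two_cos_sin (th2 - om) th2) as E2.
    pose proof (two_cos_sin (th2 - om - th) (th + th2)) as E3.
    replace (th + om + th) with (2 * th + om) in E1 by ring.
    replace (th + om - th) with om in E1 by ring.
    replace (th2 - om + th2) with (2 * th2 - om) in E2 by ring.
    replace (th2 - om - th2) with (- om) in E2 by ring.
    replace (th2 - om - th + (th + th2)) with (2 * th2 - om) in E3 by ring.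
    replace (th2 - om - th - (th + th2)) with (- (2 * th + om)) in E3 by ring.
    rewrite sin_neg in E2, E3.
    apply (Rmult_eq_compat_l Rc) in E1, E2, E3. lra.
  - pose proof (two_cos_cos (th + om) th) as E1.
    pose proof (two_cos_cos (th2 - om) th2) as E2.
    pose proof (two_sin_sin (th + th2) (th2 - om - th)) as E3.
    replace (th + om + th) with (2 * th + om) in E1 by ring.
    replace (th + om - th) with om in E1 by ring.
    replace (th2 - om + th2) with (2 * th2 - om) in E2 by ring.
    replace (th2 - om - th2) with (- om) in E2 by ring.
    replace (th + th2 + (th2 - om - th)) with (2 * th2 - om) in E3 by ring.
    replace (th + th2 - (th2 - om - th)) with (2 * th + om) in E3 by ring.
    rewrite cos_neg in E2.
    apply (Rmult_eq_compat_l Rc) in E1, E2, E3. lra.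
Qed.

(* [s] and [t] are the coordinates of a point relative to one center of the
   lens, along and across the line of centers, whose slope angle is [psi]; the
   right-hand side is attained at the corner of the lens when
   [L = 2 rho cos be]. *)
Lemma lens_drop (rho be psi L s t : R) :
  0 < be -> 0 <= psi -> be + psi <= PI / 2 -> 0 < rho ->
  2 * rho * cos be <= L ->
  s ^ 2 + t ^ 2 <= rho ^ 2 -> (L - s) ^ 2 + t ^ 2 <= rho ^ 2 ->
  s * sin psi + t * cos psi <= rho * sin (be + psi).
Proof.
  intros Hb Hp Hbp Hr HL H1 H2; pose proof PI_RGT_0.
  assert (Sb : 0 < sin be) by (apply sin_gt_0; lra).
  assert (Cb : 0 <= cos be) by (apply cos_ge_0; lra).
  assert (Sp : 0 <= sin psi) by (apply sin_ge_0; lra).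
  assert (Cp : 0 <= cos psi) by (apply cos_ge_0; lra).
  assert (Cbp : 0 <= cos (be + psi)) by (apply cos_ge_0; lra).
  assert (Hm : forall s', rho * cos be <= s' -> s' ^ 2 + t ^ 2 <= rho ^ 2 ->
     s' * sin psi + t * cos psi <= rho * sin (be + psi)).
  { intros s' Hs Hst.
    apply (Rmult_le_reg_l (sin be)); [exact Sb |].
    pose proof (sin2_cos2 be) as E; unfold Rsqr in E.
    assert (Hcs : s' * cos be + t * sin be <= rho).
    { apply Rsqr_incr_0_var; [unfold Rsqr | lra].
      assert (E0 : (s' * cos be + t * sin be) * (s' * cos be + t * sin be)
        + (s' * sin be - t * cos be) ^ 2 = (s' ^ 2 + t ^ 2) * (sin be * sin be + cos be * cos be)) by ring.
      rewrite E in E0. pose proof (pow2_ge_0 (s' * sin be - t * cos be)). nra. }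
    (* The direction [(sin psi, cos psi)] is a combination of [(cos be, sin be)] and [(-1, 0)] with
       nonnegative coefficients. The first is bounded by [rho] by Cauchy-Schwarz, the second by the
       assumed lower bound on [s']; both are tight at the corner. *)
    assert (E1 : sin be * (s' * sin psi + t * cos psi) =
       cos psi * (s' * cos be + t * sin be) - s' * cos (be + psi)) by (rewrite cos_plus; ring).
    assert (E2 : sin be * (rho * sin (be + psi)) = cos psi * rho - rho * cos be * cos (be + psi)).
    { rewrite cos_plus, sin_plus.
      transitivity (rho * cos psi * (1 - cos be * cos be) + rho * sin be * cos be * sin psi); [|ring].
      rewrite <- E; ring. }
    rewrite E1, E2; nra. }
  (* A point in the first half of the lens is reflected in the perpendicular bisector of the
     centers; as [sin psi >= 0], this does not decrease the left-hand side. *)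
  destruct (Rle_dec (L / 2) s) as [Hs | Hs].
  - apply Hm; lra.
  - apply Rle_trans with ((L - s) * sin psi + t * cos psi); [nra | apply Hm; lra].
Qed.

(* The triangle has vertices [0], [B] at angle [th] left of vertical and [A] at
   angle [th2] right of it, and circumcenter [Rc (sin om, cos om)]; the chords
   from [0] therefore have lengths [2 Rc cos (th + om)], [2 Rc cos (th2 - om)]. *)
Lemma strip_width_polar (Rc rho al be ga th th2 om x y W : R) :
  0 < Rc -> Rc <= rho ->
  0 < al <= PI / 2 -> 0 <= be <= PI / 2 -> 0 <= ga <= PI / 2 ->
  rho * cos be = Rc * cos al ->
  0 <= th -> 0 <= th2 ->
  al <= th + om -> al <= th2 - om -> th + th2 <= PI / 2 - al -> th + om <= th2 ->
  (x + 2 * Rc * cos (th + om) * sin th) ^ 2 +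
    (y - 2 * Rc * cos (th + om) * cos th) ^ 2 <= rho ^ 2 ->
  (x - 2 * Rc * cos (th2 - om) * sin th2) ^ 2 +
    (y - 2 * Rc * cos (th2 - om) * cos th2) ^ 2 <= rho ^ 2 ->
  2 * Rc * cos (th + om) * cos th <= W ->
  y + rho * sin ga <= W ->
  2 * (rho * sin ga) <= W ->
  4 * Rc * cos al * sin al * cos (be + al - ga) <= W.
Proof.
  intros HR HRr Hal Hbe Hga Hbase Hth Hth2 Ha Hb Hk Hpsi HcB HcA HWB HWc HWr.
  pose proof PI_RGT_0.
  assert (Sal : 0 < sin al) by (apply sin_gt_0; lra).
  assert (Cal : 0 < cos al) by (apply cos_gt_0; lra).
  (* The hypotheses give [2 al <= th + th2 <= PI/2 - al], hence [al <= PI/6]. *)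
  assert (Cal2 : / 2 <= cos al).
  { replace (/2) with (1/2) by field. rewrite <- cos_PI3. apply cos_le_of_abs_le; [apply Rabs_le|]; lra. }
  assert (Sal2 : sin al <= / 2).
  { replace (/2) with (1/2) by field. rewrite <- sin_PI6. apply sin_le_sin_of_between; lra. }
  assert (Hab : al <= be).
  { destruct (Rle_dec al be); [assumption | exfalso].
    assert (cos al < cos be) by (apply cos_decreasing_1; lra). nra. }
  assert (Sab : sin al <= sin be) by (apply sin_le_sin_of_between; lra).
  assert (Sga : 0 <= sin ga) by (apply sin_ge_0; lra).
  assert (E4 : 4 * Rc * cos al * sin al = 2 * Rc * sin (2 * al)) by (rewrite sin_2a; ring).
  (* If [de < 0], then [rho sin ga >= rho sin (be + al) >= 2 Rc sin al cos al], by
     [rho cos be = Rc cos al] and [rho sin be >= Rc sin al]. *)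
  destruct (Rlt_dec (be + al) ga) as [Hneg | Hpos].
  { apply Rle_trans with (2 * (rho * sin ga)); [| exact HWr].
    assert (S1 : sin (be + al) <= sin ga) by (apply sin_le_sin_of_between; lra).
    rewrite sin_plus in S1.
    pose proof (COS_bound (be + al - ga)).
    assert (0 <= Rc * cos al * sin al) by (apply Rmult_le_pos; [apply Rmult_le_pos|]; lra).
    assert (Rc * sin al <= rho * sin be) by nra.
    nra. }
  assert (Hh : 2 * Rc * cos (th + om) * cos th = Rc * (cos (2 * th + om) + cos om)).
  { pose proof (two_cos_cos (th + om) th) as E.
    replace (th + om + th) with (2 * th + om) in E by ring.
    replace (th + om - th) with om in E by ring.
    rewrite <- E; ring. }
  (* If [de > al], the height of [B] is compared with the altitude
     [2 Rc cos (th + om) cos (th2 - om)] from the origin. Written as a sum of cosines, the latter is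
     at least [Rc (sin al + sin (3 al)) = 2 Rc sin (2 al) cos al]. *)
  destruct (Rlt_dec ga be) as [Hgb | Hgb].
  { assert (C2 : cos (be + al - ga) <= cos al) by (apply cos_le_of_abs_le; [apply Rabs_le|]; lra).
    assert (C3 : cos (th2 - om) <= cos th) by (apply cos_le_of_abs_le; [apply Rabs_le|]; lra).
    assert (C4 : 0 < cos (th + om)) by (apply cos_gt_0; lra).
    assert (C5 : 2 * cos (th + om) * cos (th2 - om)
              = cos (th + th2) + cos ((th + om) - (th2 - om))).
    { rewrite Rmult_assoc, two_cos_cos; f_equal; f_equal; ring. }
    assert (C6 : sin al <= cos (th + th2)).
    { rewrite <- cos_shift; apply cos_le_of_abs_le; [apply Rabs_le|]; lra. }
    assert (C7 : sin (3 * al) <= cos ((th + om) - (th2 - om))).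
    { rewrite <- cos_shift; apply cos_le_of_abs_le; [apply Rabs_le|]; lra. }
    assert (C8 : sin al + sin (3 * al) = 2 * sin (2 * al) * cos al).
    { pose proof (two_cos_sin al (2 * al)) as E.
      replace (al + 2 * al) with (3 * al) in E by ring.
      replace (al - 2 * al) with (- al) in E by ring.
      rewrite sin_neg in E; lra. }
    assert (S2 : 0 < sin (2 * al)) by (apply sin_gt_0; lra).
    rewrite E4; apply Rle_trans with (2 := HWB).
    apply Rle_trans with (Rc * (2 * sin (2 * al) * cos al)).
    { rewrite (Rmult_comm 2 Rc), !Rmult_assoc; apply Rmult_le_compat_l; [lra |].
      apply Rmult_le_compat_l; [lra |]; apply Rmult_le_compat_l; lra. }
    apply Rle_trans with (Rc * (2 * cos (th + om) * cos (th2 - om)));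
      [apply Rmult_le_compat_l; lra |].
    rewrite (Rmult_comm 2 Rc), !Rmult_assoc; apply Rmult_le_compat_l; [lra |].
    apply Rmult_le_compat_l; [lra |]; apply Rmult_le_compat_l; lra. }
  set (de := be + al - ga) in *.
  assert (S2 : 0 < sin (2 * al)) by (apply sin_gt_0; lra).
  rewrite E4.
  (* Since [th + om <= PI/2 - 2 al], the side from the origin to [B] is at least [2 Rc sin (2 al)];
     if it also leans by at most [de], then [B] is high enough. *)
  destruct (Rle_dec th de) as [Hd | Hd].
  { apply Rle_trans with (2 := HWB).
    assert (cos de <= cos th) by (apply cos_le_of_abs_le; [apply Rabs_le|]; unfold de in *; lra).
    assert (sin (2 * al) <= cos (th + om)).
    { rewrite <- cos_shift; apply cos_le_of_abs_le; [apply Rabs_le|]; lra. }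
    assert (0 <= cos de) by (apply cos_ge_0; unfold de in *; lra).
    rewrite !(Rmult_assoc (2 * Rc)); apply Rmult_le_compat_l; [lra |].
    apply Rmult_le_compat; lra. }
  (* The height of [B] becomes [Rc (sin y0 + cos om)], and the bound is
     [Rc (sin (2 al - de) + sin (2 al + de))]. For [y0 >= 2 al - de] the comparison holds term by
     term. *)
  set (y0 := PI / 2 - (2 * th + om)).
  assert (Hy0 : cos (2 * th + om) = sin y0) by (unfold y0; now rewrite sin_shift).
  rewrite Hy0 in Hh.
  destruct (Rle_dec (2 * al - de) y0) as [Hy | Hy].
  { apply Rle_trans with (2 := HWB). rewrite Hh.
    replace (2 * Rc * sin (2 * al) * cos de) with (Rc * (sin (2 * al - de) + sin (2 * al + de)))
      by (rewrite sin_minus, sin_plus; ring).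
    apply Rmult_le_compat_l; [lra |]; apply Rplus_le_compat.
    - apply sin_le_sin_of_between; unfold y0, de in *; lra.
    - rewrite <- (cos_shift (_ + _)); apply cos_le_of_abs_le; [apply Rabs_le|]; unfold y0, de in *; lra. }
  set (ka := th + th2). set (psi := th2 - om - th).
  (* [cb] replaces the base angle of the isosceles triangle [A B corner]: it is
     at least that angle, as [acos (m cos t) - t] decreases in [t] for
     [m = Rc / rho <= 1]. *)
  set (cb := PI / 2 - ka + (be - al)).
  assert (HL : 2 * rho * cos cb <= 2 * Rc * sin ka).
  { apply (Rmult_le_reg_r (cos al)); [exact Cal |].
    set (e := be - al) in *.
    assert (Ecb : cos cb = sin ka * cos e - cos ka * sin e).
    { unfold cb. rewrite cos_plus, cos_shift, sin_shift. ring. }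
    assert (Ebe : cos be = cos al * cos e - sin al * sin e).
    { replace be with (al + e) by (unfold e; ring). apply cos_plus. }
    assert (Se : 0 <= sin e) by (apply sin_ge_0; unfold e; lra).
    assert (Sd : 0 <= cos (al + ka)) by (apply cos_ge_0; unfold ka; lra).
    rewrite cos_plus in Sd.
    replace (2 * Rc * sin ka * cos al) with (2 * sin ka * (rho * cos be)) by (rewrite Hbase; ring).
    rewrite Ecb, Ebe.
    assert (0 <= rho * (sin e * (cos al * cos ka - sin al * sin ka))) by (repeat apply Rmult_le_pos; lra).
    lra. }
  set (p := 2 * Rc * cos (th + om)) in *.
  set (q := 2 * Rc * cos (th2 - om)) in *.
  destruct (chord_coordinates Rc th th2 om) as [Ex Ey].
  fold p q ka psi in Ex, Ey.
  (* The coordinates given to [lens_drop] are relative to [B]: the first along the side towards [A],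
     the second perpendicular to it and pointing down. The depth of the incenter below [B] is then
     the left-hand side of that lemma. *)
  assert (Hdrop : p * cos th - y <= rho * sin (cb + psi)).
  { pose proof (lens_drop rho cb psi (2 * Rc * sin ka)
      ((x + p * sin th) * cos psi - (y - p * cos th) * sin psi)
      (- (x + p * sin th) * sin psi - (y - p * cos th) * cos psi)) as Hl.
    pose proof (sin2_cos2 psi) as Epsi; unfold Rsqr in Epsi.
    match type of Hl with _ -> _ -> _ -> _ -> _ -> _ -> _ -> ?l <= _ =>
      replace l with (p * cos th - y) in Hl end.
    2: { transitivity ((p * cos th - y) * (sin psi * sin psi + cos psi * cos psi)); [rewrite Epsi; ring | ring]. }
    apply Hl; clear Hl.
    1-4: unfold cb, psi, ka, y0, de in *; lra.
    - exact HL.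
    - apply Rle_trans with (2 := HcB); apply Req_le.
      transitivity (((x + p * sin th) ^ 2 + (y - p * cos th) ^ 2) * (sin psi * sin psi + cos psi * cos psi));
       [ring | rewrite Epsi; ring].
    - apply Rle_trans with (2 := HcA); apply Req_le.
      transitivity ((2 * Rc * sin ka * cos psi - (x + p * sin th)) ^ 2 +
         (2 * Rc * sin ka * sin psi + (y - p * cos th)) ^ 2).
      + set (L := 2 * Rc * sin ka) in *.
        transitivity (L ^ 2 - 2 * L * ((x + p * sin th) * cos psi - (y - p * cos th) * sin psi)
           + ((x + p * sin th) ^ 2 + (y - p * cos th) ^ 2) * (sin psi * sin psi + cos psi * cos psi));
         [ring | rewrite Epsi].
        transitivity (L ^ 2 * (sin psi * sin psi + cos psi * cos psi) - 2 * L * ((x + p * sin th) * cos psi - (y - p * cos th) * sin psi)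
           + ((x + p * sin th) ^ 2 + (y - p * cos th) ^ 2)); [rewrite Epsi; ring | ring].
      + rewrite <- Ex.
        replace (2 * Rc * sin ka * sin psi) with (- (q * cos th2 - p * cos th)) by (rewrite Ey; ring). ring. }
  (* Both the height of [B] and the drop are now bounded in terms of [z] alone, so [y >= 2 Rc sin (2
     al) cos z - rho sin (al + be - z)]. At [z = de] the last sine is [sin ga], which cancels the
     inradius [rho sin ga] and leaves exactly the bound. *)
  set (z := 2 * al - y0) in *.
  assert (Hz : cb + psi = al + be - z) by (unfold cb, psi, ka, z, y0; field).
  rewrite Hz in Hdrop.
  assert (Hhz : 2 * Rc * sin (2 * al) * cos z <= p * cos th).
  { rewrite Hh.
    replace (2 * Rc * sin (2 * al) * cos z) with (Rc * (sin (2 * al - z) + sin (2 * al + z)))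
      by (rewrite sin_minus, sin_plus; ring).
    apply Rmult_le_compat_l; [lra |]; apply Rplus_le_compat.
    - apply Req_le; f_equal; unfold z; ring.
    - rewrite <- (cos_shift (_ + _)); apply cos_le_of_abs_le; [apply Rabs_le|]; unfold z, y0, de in *; lra. }
  assert (Hde : 0 <= de) by (unfold de; lra).
  assert (Hzr : de <= z <= al) by (unfold z, y0, de in *; lra).
  assert (Sbg : rho * sin be <= rho * sin ga).
  { apply Rmult_le_compat_l; [lra | apply sin_le_sin_of_between; lra]. }
  destruct (Rle_dec (rho * sin be) (2 * Rc * sin (2 * al) * cos al)) as [HP | HP].
  - (* For the extremal triangle, with angle [2 al] opposite the side from [0]
       to [B], the lens corner has height [P cos (al - z) - S sin (al - z)] at
       tilt [z]; as [P, S >= 0], it is lowest at [z = de]. *)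
    set (P := 2 * Rc * sin (2 * al) * cos al - rho * sin be).
    set (S := Rc * cos al * (1 - 4 * (sin al * sin al))).
    assert (HQ : forall t, 2 * Rc * sin (2 * al) * cos t - rho * sin (al + be - t)
       = P * cos (al - t) - S * sin (al - t)).
    { intros t. unfold P, S.
      replace (cos t) with (cos (al - (al - t))) by (f_equal; ring).
      replace (al + be - t) with (be + (al - t)) by ring.
      rewrite cos_minus, sin_plus, sin_2a.
      transitivity ((4 * Rc * sin al * cos al * cos al - rho * sin be) * cos (al - t)
        + (4 * Rc * sin al * cos al * sin al - rho * cos be) * sin (al - t)); [ring | rewrite Hbase; ring]. }
    assert (HS : 0 <= S).
    { unfold S; apply Rmult_le_pos; [apply Rmult_le_pos; lra | nra]. }
    pose proof (HQ z) as Qz. pose proof (HQ de) as Qd.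
    replace (al + be - de) with ga in Qd by (unfold de; ring).
    assert (P * cos (al - de) <= P * cos (al - z)).
    { apply Rmult_le_compat_l; [unfold P; lra |].
      apply cos_le_of_abs_le; [apply Rabs_le|]; lra. }
    assert (S * sin (al - z) <= S * sin (al - de)).
    { apply Rmult_le_compat_l; [exact HS |]. apply sin_le_sin_of_between; lra. }
    lra.
  (* Here [rho sin ga >= rho sin be > 2 Rc sin (2 al) cos al], and [cos al >= 1/2] makes twice this
     exceed [2 Rc sin (2 al)]. *)
  - assert (cos de <= 1) by apply COS_bound.
    assert (0 <= Rc * sin (2 * al)) by (apply Rmult_le_pos; lra).
    assert (Rc * sin (2 * al) * cos de <= Rc * sin (2 * al) * 1) by (apply Rmult_le_compat_l; lra).
    assert (Rc * sin (2 * al) * / 2 <= Rc * sin (2 * al) * cos al) by (apply Rmult_le_compat_l; lra).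
    lra.
Qed.

(** * Triangles in a strip *)

Definition width_bound (r D Rc : R) : R :=
  2 * D * sqrt (1 - (D / (2 * Rc)) ^ 2) *
  cos (acos (D / (2 * (D - r))) + acos (D / (2 * Rc)) - asin (r / (D - r))).

Lemma polar_upper (x y : R) : 0 < x ^ 2 + y ^ 2 -> 0 <= y ->
  exists l t, 0 < l /\ - (PI / 2) <= t <= PI / 2 /\ x = l * sin t /\ y = l * cos t.
Proof.
  intros H Hy; set (l := sqrt (x ^ 2 + y ^ 2)).
  assert (Hl : 0 < l) by (now apply sqrt_lt_R0).
  assert (Hl2 : l * l = x ^ 2 + y ^ 2) by (apply sqrt_sqrt; lra).
  assert (Hx : -1 <= x / l <= 1).
  { assert (- l <= x <= l) by (split; nra).
    split; apply (Rmult_le_reg_r l); try exact Hl; unfold Rdiv;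
      rewrite Rmult_assoc, Rinv_l; lra. }
  exists l, (asin (x / l)); repeat split; try apply asin_bound; try exact Hl.
  - rewrite sin_asin by exact Hx. field. lra.
  - rewrite cos_asin by exact Hx.
    replace (1 - Rsqr (x / l)) with (Rsqr (y / l)).
    + rewrite sqrt_Rsqr; [field; lra |].
      apply Rmult_le_pos; [exact Hy | apply Rlt_le, Rinv_0_lt_compat, Hl].
    + unfold Rsqr. apply (Rmult_eq_reg_r (l * l)); [| nra].
      transitivity (y * y); [field; lra |].
      transitivity (l * l - x * x); [rewrite Hl2; ring | field; lra].
Qed.

(** Circumcenter and vertices lie in the upper half-plane, so they have polar angles from the
    vertical. A chord from the origin satisfies [2 o.X = X.X], which gives its length; the bound [D]
    on sides and the non-obtuse angles then become the angle inequalities of [strip_width_polar]. *)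
Lemma ordered_strip_origin (Rc D r W ox oy ax ay bx by_ cx cy : R) :
  0 < Rc -> 0 <= r -> Rc <= D - r -> D < 2 * Rc -> D <= 2 * (D - r) ->
  ox ^ 2 + oy ^ 2 = Rc ^ 2 ->
  (ax - ox) ^ 2 + (ay - oy) ^ 2 = Rc ^ 2 ->
  (bx - ox) ^ 2 + (by_ - oy) ^ 2 = Rc ^ 2 ->
  0 < ax ^ 2 + ay ^ 2 <= D ^ 2 ->
  0 < bx ^ 2 + by_ ^ 2 <= D ^ 2 ->
  0 < (ax - bx) ^ 2 + (ay - by_) ^ 2 <= D ^ 2 ->
  0 <= ax * bx + ay * by_ ->
  0 <= ax * (ax - bx) + ay * (ay - by_) ->
  0 <= bx * (bx - ax) + by_ * (by_ - ay) ->
  bx <= 0 <= ax -> 0 <= ay <= by_ ->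
  (cx - ax) ^ 2 + (cy - ay) ^ 2 <= (D - r) ^ 2 ->
  (cx - bx) ^ 2 + (cy - by_) ^ 2 <= (D - r) ^ 2 ->
  by_ <= W -> cy + r <= W -> 2 * r <= W ->
  width_bound r D Rc <= W.
Proof.
  intros HR Hr HRr HD HDr Ho HAo HBo HA HB HAB HC1 HA1 HB1 Hx Hy HcA HcB HW1 HW2 HW3.
  pose proof PI_RGT_0.
  (* Eliminating [ox] from the chord equations of [A] and [B] expresses [oy] times the cross product
     of [A] and [B] as a nonnegative quantity. A vanishing cross product contradicts the triangle
     conditions. *)
  assert (Hoy : 0 <= oy).
  { assert (E1 : 2 * (ox * ax + oy * ay) = ax ^ 2 + ay ^ 2) by lra.
    assert (E2 : 2 * (ox * bx + oy * by_) = bx ^ 2 + by_ ^ 2) by lra.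
    assert (E3 : 2 * oy * (by_ * ax - bx * ay) = ax * (bx ^ 2 + by_ ^ 2) - bx * (ax ^ 2 + ay ^ 2))
      by (rewrite <- E1, <- E2; ring).
    assert (0 <= 2 * oy * (by_ * ax - bx * ay)) by 
      (rewrite E3; pose proof (Rmult_le_pos ax (bx ^ 2 + by_ ^ 2) ltac:(lra) ltac:(lra));
       pose proof (Rmult_le_pos (- bx) (ax ^ 2 + ay ^ 2) ltac:(lra) ltac:(lra)); lra).
    assert (0 <= by_ * ax) by (apply Rmult_le_pos; lra).
    assert (0 <= - bx * ay) by (apply Rmult_le_pos; lra).
    destruct (Rlt_dec 0 (by_ * ax - bx * ay)) as [Hp | Hp]; [nra | exfalso].
    assert (Z1 : by_ * ax = 0) by lra. assert (Z2 : bx * ay = 0) by lra.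
    destruct (Rmult_integral _ _ Z1) as [Z | Z].
    - assert (ay = 0) by lra. subst ay by_.
      assert (0 < ax) by nra. assert (bx < 0) by nra. nra.
    - subst ax. destruct (Rmult_integral _ _ Z2) as [Z' | Z'].
      + subst bx. assert (0 < ay) by nra. assert (0 < by_) by nra.
        assert (2 * oy = ay) by nra. assert (2 * oy = by_) by nra. nra.
      + subst ay. nra. }
  destruct (polar_upper ox oy) as (l & om & Hl & Hom & -> & ->); [nra | exact Hoy |].
  assert (l = Rc).
  { pose proof (sin2_cos2 om) as E; unfold Rsqr in E.
    assert (l * l = Rc * Rc).
    { transitivity (l * l * (sin om * sin om + cos om * cos om)); [rewrite E; ring | lra]. }
    nra. }
  subst l.
  destruct (polar_upper (- bx) by_) as (p & th & Hp & Hth & Eb1 & Eb2); [nra | lra |].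
  destruct (polar_upper ax ay) as (q & th2 & Hq & Hth2 & -> & ->); [nra | lra |].
  assert (bx = - (p * sin th)) by lra. subst bx by_. clear Eb1.
  assert (Hth0 : 0 <= th).
  { destruct (Rle_dec 0 th); [assumption | exfalso].
    assert (sin th < 0) by (apply sin_lt_0_var; lra). nra. }
  assert (Hth20 : 0 <= th2).
  { destruct (Rle_dec 0 th2); [assumption | exfalso].
    assert (sin th2 < 0) by (apply sin_lt_0_var; lra). nra. }
  pose proof (sin2_cos2 th) as Eth; unfold Rsqr in Eth.
  pose proof (sin2_cos2 th2) as Eth2; unfold Rsqr in Eth2.
  pose proof (sin2_cos2 om) as Eom; unfold Rsqr in Eom.
  assert (Ep : p = 2 * Rc * cos (th + om)).
  { apply (Rmult_eq_reg_l p); [| lra]. rewrite cos_plus.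
    transitivity (p * p * (sin th * sin th + cos th * cos th)); [rewrite Eth; ring | lra]. }
  assert (Eq : q = 2 * Rc * cos (th2 - om)).
  { apply (Rmult_eq_reg_l q); [| lra]. rewrite cos_minus.
    transitivity (q * q * (sin th2 * sin th2 + cos th2 * cos th2)); [rewrite Eth2; ring | lra]. }
  assert (Cp : 0 < cos (th + om)) by (apply (Rmult_lt_reg_l (2 * Rc)); lra).
  assert (Cq : 0 < cos (th2 - om)) by (apply (Rmult_lt_reg_l (2 * Rc)); lra).
  assert (Ck : 0 <= cos (th + th2)) by (rewrite cos_plus;
    apply (Rmult_le_reg_l (p * q)); [now apply Rmult_lt_0_compat | lra]).
  assert (Hk : th + th2 <= PI / 2).
  { destruct (Rle_dec (th + th2) (PI / 2)); [assumption | exfalso].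
    assert (cos (th + th2) < 0) by (apply cos_lt_0; lra). lra. }
  assert (Hk0 : 0 < th + th2).
  { destruct (Rlt_dec 0 (th + th2)); [assumption | exfalso].
    assert (th = 0) by lra. assert (th2 = 0) by lra. subst th th2.
    replace (0 - om) with (- om) in Eq by ring. rewrite cos_neg in Eq.
    rewrite Rplus_0_l in Ep. rewrite <- Ep in Eq. subst q. rewrite sin_0 in HAB. lra. }
  assert (Sk : 0 < sin (th + th2)) by (apply sin_gt_0; lra).
  assert (U1 : th + om < PI / 2).
  { destruct (Rlt_dec (th + om) (PI / 2)); [assumption | exfalso].
    assert (cos (th + om) <= 0) by (apply cos_le_0; lra). lra. }
  assert (U2 : th2 - om < PI / 2).
  { destruct (Rlt_dec (th2 - om) (PI / 2)); [assumption | exfalso].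
    assert (cos (th2 - om) <= 0) by (apply cos_le_0; lra). lra. }
  (* The angle at [A] is not obtuse, so [q >= p cos (th + th2)], and this difference equals
     [2 Rc sin (th + th2) sin (th + om)]. The same argument at [B] gives [S2]. *)
  assert (S1 : 0 <= sin (th + om)).
  { assert (p * cos (th + th2) <= q).
    { rewrite cos_plus. apply (Rmult_le_reg_l q); [exact Hq |].
      assert (q * q * (sin th2 * sin th2 + cos th2 * cos th2) = q * q) by (rewrite Eth2; ring). lra. }
    assert (E : cos (th2 - om) = cos (th + th2) * cos (th + om) + sin (th + th2) * sin (th + om)).
    { rewrite <- cos_minus. f_equal; ring. }
    apply (Rmult_le_reg_l (2 * Rc * sin (th + th2))).
    { apply Rmult_lt_0_compat; lra. }
    apply (Rmult_eq_compat_l (2 * Rc)) in E. rewrite <- Eq in E.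
    apply (Rmult_eq_compat_r (cos (th + th2))) in Ep. lra. }
  assert (S2 : 0 <= sin (th2 - om)).
  { assert (q * cos (th + th2) <= p).
    { rewrite cos_plus. apply (Rmult_le_reg_l p); [exact Hp |].
      assert (p * p * (sin th * sin th + cos th * cos th) = p * p) by (rewrite Eth; ring). lra. }
    assert (E : cos (th + om) = cos (th + th2) * cos (th2 - om) + sin (th + th2) * sin (th2 - om)).
    { rewrite <- cos_minus. f_equal; ring. }
    apply (Rmult_le_reg_l (2 * Rc * sin (th + th2))).
    { apply Rmult_lt_0_compat; lra. }
    apply (Rmult_eq_compat_l (2 * Rc)) in E. rewrite <- Ep in E.
    apply (Rmult_eq_compat_r (cos (th + th2))) in Eq. lra. }
  set (al := acos (D / (2 * Rc))).
  set (be := acos (D / (2 * (D - r)))).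
  set (ga := asin (r / (D - r))).
  assert (HD0 : 0 < D) by lra.
  assert (X1 : 0 < D / (2 * Rc) < 1).
  { split; [apply Rdiv_lt_0_compat; lra |]. apply (Rmult_lt_reg_r (2 * Rc)); [lra |].
    unfold Rdiv; rewrite Rmult_assoc, Rinv_l; lra. }
  assert (X2 : 0 < D / (2 * (D - r)) <= 1).
  { split; [apply Rdiv_lt_0_compat; lra |]. apply (Rmult_le_reg_r (2 * (D - r))); [lra |].
    unfold Rdiv; rewrite Rmult_assoc, Rinv_l; lra. }
  assert (X3 : 0 <= r / (D - r) <= 1).
  { split; [apply Rdiv_le_0_compat; lra |]. apply (Rmult_le_reg_r (D - r)); [lra |].
    unfold Rdiv; rewrite Rmult_assoc, Rinv_l; lra. }
  assert (Cal : cos al = D / (2 * Rc)) by (apply cos_acos; lra).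
  assert (Cbe : cos be = D / (2 * (D - r))) by (apply cos_acos; lra).
  assert (Sga : sin ga = r / (D - r)) by (apply sin_asin; lra).
  assert (Hal : 0 < al <= PI / 2).
  { pose proof (acos_bound (D / (2 * Rc))) as B. fold al in B. split.
    - destruct (Rle_lt_or_eq_dec 0 al (proj1 B)) as [| Z]; [assumption | exfalso].
      rewrite <- Z, cos_0 in Cal. lra.
    - destruct (Rle_dec al (PI / 2)); [assumption | exfalso].
      assert (cos al < 0) by (apply cos_lt_0; lra). lra. }
  assert (Hbe : 0 <= be <= PI / 2).
  { pose proof (acos_bound (D / (2 * (D - r)))) as B. fold be in B. split; [lra |].
    destruct (Rle_dec be (PI / 2)); [assumption | exfalso].
    assert (cos be < 0) by (apply cos_lt_0; lra). lra. }
  assert (Hga : 0 <= ga <= PI / 2).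
  { pose proof (asin_bound (r / (D - r))) as B. fold ga in B. split; [| lra].
    destruct (Rle_dec 0 ga); [assumption | exfalso].
    assert (sin ga < 0) by (apply sin_lt_0_var; lra). lra. }
  assert (ED : 2 * Rc * cos al = D) by (rewrite Cal; field; lra).
  assert (Er : (D - r) * sin ga = r) by (rewrite Sga; field; lra).
  assert (Ew : width_bound r D Rc = 4 * Rc * cos al * sin al * cos (be + al - ga)).
  { unfold width_bound. fold al be ga.
    replace (sqrt (1 - (D / (2 * Rc)) ^ 2)) with (sin al).
    - replace (4 * Rc * cos al) with (2 * (2 * Rc * cos al)) by ring. rewrite ED. ring.
    - unfold al; rewrite sin_acos by lra. f_equal. unfold Rsqr; ring. }
  rewrite Ew.
  (* As [D = 2 Rc cos al], a chord [2 Rc cos u] of length at most [D] forces [u >= al]. This is used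
     for all three sides. *)
  assert (Hcmp : forall u, - (PI / 2) <= u < PI / 2 -> 0 <= sin u -> 2 * Rc * cos u <= D -> al <= u).
  { intros u Hu Su Hc.
    assert (0 <= u).
    { destruct (Rle_dec 0 u); [assumption | exfalso].
      assert (sin u < 0) by (apply sin_lt_0_var; lra). lra. }
    destruct (Rle_dec al u); [assumption | exfalso].
    assert (cos al < cos u) by (apply cos_decreasing_1; lra). nra. }
  assert (Hpal : al <= th + om).
  { apply Hcmp; [lra | exact S1 | rewrite <- Ep].
    assert (X : p * p * (sin th * sin th + cos th * cos th) <= D * D) by lra.
    rewrite Eth in X. nra. }
  assert (Hqal : al <= th2 - om).
  { apply Hcmp; [lra | exact S2 | rewrite <- Eq].
    assert (X : q * q * (sin th2 * sin th2 + cos th2 * cos th2) <= D * D) by lra.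
    rewrite Eth2 in X. nra. }
  destruct (chord_coordinates Rc th th2 om) as [Ex Ey]. rewrite <- Ep, <- Eq in Ex, Ey.
  set (psi := th2 - om - th) in *.
  pose proof (sin2_cos2 psi) as Epsi; unfold Rsqr in Epsi.
  assert (HLk : 2 * Rc * sin (th + th2) <= D).
  { apply Rsqr_incr_0_var; [unfold Rsqr | lra].
    apply Rle_trans with ((2 * Rc * sin (th + th2)) ^ 2 * (sin psi * sin psi + cos psi * cos psi)).
    - rewrite Epsi; lra.
    - apply Rle_trans with ((p * sin th + q * sin th2) ^ 2 + (q * cos th2 - p * cos th) ^ 2); [rewrite Ex, Ey; lra | lra]. }
  assert (Hkal : th + th2 <= PI / 2 - al).
  { assert (al <= PI / 2 - (th + th2)); [| lra].
    apply Hcmp; [lra | apply sin_ge_0; lra | now rewrite cos_shift]. }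
  assert (Hpsi : 0 <= psi).
  { destruct (Rle_dec 0 psi); [assumption | exfalso].
    assert (sin psi < 0) by (apply sin_lt_0_var; unfold psi in *; lra).
    assert (0 < 2 * Rc * sin (th + th2) * - sin psi) by (repeat apply Rmult_lt_0_compat; lra).
    lra. }
  apply (strip_width_polar Rc (D - r) al be ga th th2 om cx cy W); try lra.
  - rewrite Cbe, Cal; field; lra.
  - unfold psi in Hpsi; lra.
  - rewrite <- Ep; lra.
  - rewrite <- Eq; lra.
  - rewrite <- Ep; lra.
Qed.

(** * Reduction of an arbitrary horizontal strip to the normalized one *)

Definition vertex (Rc rho m M : R) (o c p : pt) : Prop :=
  dist2 p o ^ 2 = Rc ^ 2 /\ dist2 p c ^ 2 <= rho ^ 2 /\ m <= snd p <= M.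

Definition dotat (p q s : pt) : R :=
  (fst q - fst p) * (fst s - fst p) + (snd q - snd p) * (snd s - snd p).

Definition corner (D : R) (p q s : pt) : Prop :=
  0 <= dotat p q s /\ 0 < dist2 q s ^ 2 <= D ^ 2.

(** Symmetric in the three vertices, so that they can be sorted by height. *)
Definition strip_config (Rc D rho m M : R) (o c p q s : pt) : Prop :=
  vertex Rc rho m M o c p /\ vertex Rc rho m M o c q /\ vertex Rc rho m M o c s /\
  corner D p q s /\ corner D q s p /\ corner D s p q.

Lemma dist2_sq (p q : pt) : dist2 p q ^ 2 = (fst p - fst q) ^ 2 + (snd p - snd q) ^ 2.
Proof.
  unfold dist2; rewrite pow2_sqrt; [reflexivity |].
  apply Rplus_le_le_0_compat; apply pow2_ge_0.
Qed.

Lemma corner_sym D p q s : corner D p q s -> corner D p s q.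
Proof. unfold corner, dotat; rewrite !dist2_sq; intros; lra. Qed.

Lemma strip_config_swap12 Rc D rho m M o c p q s :
  strip_config Rc D rho m M o c p q s -> strip_config Rc D rho m M o c q p s.
Proof.
  intros (H1 & H2 & H3 & H4 & H5 & H6); unfold strip_config; auto 10 using corner_sym.
Qed.

Lemma strip_config_swap23 Rc D rho m M o c p q s :
  strip_config Rc D rho m M o c p q s -> strip_config Rc D rho m M o c p s q.
Proof.
  intros (H1 & H2 & H3 & H4 & H5 & H6); unfold strip_config; auto 10 using corner_sym.
Qed.

Lemma strip_config_map (f : pt -> pt) Rc D rho m M m' M' o c p q s :
  (forall a b, dist2 (f a) (f b) ^ 2 = dist2 a b ^ 2) ->
  (forall a b d, dotat (f a) (f b) (f d) = dotat a b d) ->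
  (forall a, m <= snd a <= M -> m' <= snd (f a) <= M') ->
  strip_config Rc D rho m M o c p q s ->
  strip_config Rc D rho m' M' (f o) (f c) (f p) (f q) (f s).
Proof.
  intros Hd Hdot Hs H; unfold strip_config, vertex, corner in *.
  rewrite !Hd, !Hdot; repeat split; try apply H; apply Hs; apply H.
Qed.

Section Strip.

Variables Rc D r : R.
Hypotheses (HR : 0 < Rc) (Hr : 0 <= r) (HRr : Rc <= D - r) (HD : D < 2 * Rc)
  (HDr : D <= 2 * (D - r)).

Let flipx (p : pt) : pt := (- fst p, snd p).
Let flipy (p : pt) : pt := (fst p, - snd p).

Lemma bound_of_ordered m M o c p q s :
  strip_config Rc D (D - r) m M o c p q s ->
  m <= snd c - r -> snd c + r <= M ->
  snd p <= snd q <= snd s -> fst s <= fst p <= fst q ->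
  width_bound r D Rc <= M - m.
Proof.
  intros (Vp & Vq & Vs & Cp & Cq & Cs) Hm HM Hy Hx.
  unfold vertex, corner, dotat in *; rewrite !dist2_sq in *.
  apply (ordered_strip_origin Rc D r (M - m)
    (fst o - fst p) (snd o - snd p) (fst q - fst p) (snd q - snd p)
    (fst s - fst p) (snd s - snd p) (fst c - fst p) (snd c - snd p)); lra.
Qed.

Lemma bound_of_cone m M o c p q s :
  strip_config Rc D (D - r) m M o c p q s ->
  m <= snd c - r -> snd c + r <= M ->
  snd p <= snd q <= snd s ->
  fst s <= fst p <= fst q \/ fst q <= fst p <= fst s ->
  width_bound r D Rc <= M - m.
Proof.
  intros H Hm HM Hy [Hx | Hx]; [now apply (bound_of_ordered m M o c p q s) |].
  apply (bound_of_ordered m M (flipx o) (flipx c) (flipx p) (flipx q) (flipx s)); simpl; try lra.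
  revert H; apply strip_config_map; intros.
  - rewrite !dist2_sq; simpl; ring.
  - unfold dotat; simpl; ring.
  - simpl; lra.
Qed.

(** The lowest or the highest vertex lies horizontally between the other two. Otherwise the middle
    one would lie between them in both coordinates, and the angle there would be obtuse. A vertical
    reflection exchanges the two good cases. *)
Lemma bound_of_sorted m M o c p q s :
  strip_config Rc D (D - r) m M o c p q s ->
  m <= snd c - r -> snd c + r <= M ->
  snd p <= snd q <= snd s ->
  width_bound r D Rc <= M - m.
Proof.
  intros H Hm HM Hy.
  destruct (classic (fst s <= fst p <= fst q \/ fst q <= fst p <= fst s)) as [Hx | Hx];
    [now apply (bound_of_cone m M o c p q s) |].
  destruct (classic (fst p <= fst s <= fst q \/ fst q <= fst s <= fst p)) as [Hx' | Hx'].
  - replace (M - m) with (- m - - M) by ring.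
    apply (bound_of_cone (- M) (- m) (flipy o) (flipy c) (flipy s) (flipy q) (flipy p));
      simpl; try lra.
    apply strip_config_swap12, strip_config_swap23, strip_config_swap12.
    revert H; apply strip_config_map; intros.
    + rewrite !dist2_sq; simpl; ring.
    + unfold dotat; simpl; ring.
    + simpl; lra.
  - exfalso. destruct H as (_ & _ & _ & _ & (Hq & _) & _); unfold dotat in Hq.
    destruct (Rle_dec (fst p) (fst q)); destruct (Rle_dec (fst q) (fst s)); try lra; nra.
Qed.

Lemma width_bound_le_strip m M o c p q s :
  strip_config Rc D (D - r) m M o c p q s ->
  m <= snd c - r -> snd c + r <= M ->
  width_bound r D Rc <= M - m.
Proof.
  intros H Hm HM.
  pose proof (strip_config_swap12 _ _ _ _ _ _ _ _ _ _ H) as H12.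
  pose proof (strip_config_swap23 _ _ _ _ _ _ _ _ _ _ H) as H23.
  pose proof (strip_config_swap23 _ _ _ _ _ _ _ _ _ _ H12) as H1223.
  pose proof (strip_config_swap12 _ _ _ _ _ _ _ _ _ _ H23) as H2312.
  pose proof (strip_config_swap12 _ _ _ _ _ _ _ _ _ _ H1223) as H121.
  destruct (Rle_dec (snd p) (snd q)); destruct (Rle_dec (snd q) (snd s));
    destruct (Rle_dec (snd p) (snd s));
    solve [ apply (bound_of_sorted _ _ _ _ _ _ _ H); lra
          | apply (bound_of_sorted _ _ _ _ _ _ _ H12); lra
          | apply (bound_of_sorted _ _ _ _ _ _ _ H23); lra
          | apply (bound_of_sorted _ _ _ _ _ _ _ H1223); lra
          | apply (bound_of_sorted _ _ _ _ _ _ _ H2312); lra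
          | apply (bound_of_sorted _ _ _ _ _ _ _ H121); lra ].
Qed.

End Strip.

(** * Compactness in the plane *)

Lemma dist2_pos (p q : pt) : 0 <= dist2 p q.
Proof. apply sqrt_pos. Qed.

Lemma dist2_sym (p q : pt) : dist2 p q = dist2 q p.
Proof. unfold dist2; f_equal; ring. Qed.

Lemma dist2_refl (p : pt) : dist2 p p = 0.
Proof. unfold dist2; rewrite <- sqrt_0; f_equal; ring. Qed.

Lemma dist2_triangle (p q s : pt) : dist2 p s <= dist2 p q + dist2 q s.
Proof.
  pose proof (triangle (fst p) (snd p) (fst s) (snd s) (fst q) (snd q)) as H.
  unfold dist_euc in H; rewrite !Rsqr_pow2 in H; exact H.
Qed.

Lemma dist2_le (p q : pt) (d : R) :
  0 <= d -> (fst p - fst q) ^ 2 + (snd p - snd q) ^ 2 <= d ^ 2 -> dist2 p q <= d.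
Proof.
  intros Hd H; rewrite <- dist2_sq in H; pose proof (dist2_pos p q); nra.
Qed.

Lemma dist2_le_abs (p q : pt) :
  dist2 p q <= Rabs (fst p - fst q) + Rabs (snd p - snd q).
Proof.
  pose proof (Rabs_pos (fst p - fst q)); pose proof (Rabs_pos (snd p - snd q)).
  apply dist2_le; [lra |]. rewrite <- (pow2_abs (fst p - _)), <- (pow2_abs (snd p - _)); nra.
Qed.

Lemma abs_le_dist2 (p q : pt) :
  Rabs (fst p - fst q) <= dist2 p q /\ Rabs (snd p - snd q) <= dist2 p q.
Proof.
  pose proof (dist2_sq p q) as H; rewrite <- (pow2_abs (fst p - _)), <- (pow2_abs (snd p - _)) in H.
  pose proof (dist2_pos p q).
  pose proof (Rabs_pos (fst p - fst q)); pose proof (Rabs_pos (snd p - snd q)). split; nra.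
Qed.

(** [real] sends infinite values to 0, so nonemptiness and a bound are what make the result a true
    supremum. *)
Lemma lub_real (E : R -> Prop) (M : R) :
  (exists x, E x) -> (forall x, E x -> x <= M) ->
  (forall x, E x -> x <= real (Lub_Rbar E)) /\
  (forall b, (forall x, E x -> x <= b) -> real (Lub_Rbar E) <= b).
Proof.
  intros [x Hx] HM; destruct (Lub_Rbar_correct E) as [Hub Hl].
  pose proof (Hub x Hx) as H1. pose proof (Hl M (fun y Hy => HM y Hy)) as H2.
  destruct (Lub_Rbar E) as [l | |]; simpl in *; try contradiction.
  split; [intros y Hy; exact (Hub y Hy) | intros b Hb; exact (Hl b (fun y Hy => Hb y Hy))].
Qed.

Lemma glb_real (E : R -> Prop) (m : R) :
  (exists x, E x) -> (forall x, E x -> m <= x) ->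
  (forall x, E x -> real (Glb_Rbar E) <= x) /\
  (forall b, (forall x, E x -> b <= x) -> b <= real (Glb_Rbar E)).
Proof.
  intros [x Hx] HM; destruct (Glb_Rbar_correct E) as [Hub Hl].
  pose proof (Hub x Hx) as H1. pose proof (Hl m (fun y Hy => HM y Hy)) as H2.
  destruct (Glb_Rbar E) as [l | |]; simpl in *; try contradiction.
  split; [intros y Hy; exact (Hub y Hy) | intros b Hb; exact (Hl b (fun y Hy => Hb y Hy))].
Qed.

Lemma inv_INR_S_pos (n : nat) : 0 < / INR (S n).
Proof. apply Rinv_0_lt_compat, lt_0_INR; lia. Qed.

Lemma inv_INR_S_small (eps : R) : 0 < eps ->
  exists N, forall n, (N <= n)%nat -> / INR (S n) < eps.
Proof.
  intros He; destruct (archimed_cor1 eps He) as (N & H1 & H2).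
  exists N; intros n Hn. apply Rle_lt_trans with (2 := H1).
  apply Rinv_le_contravar; [now apply lt_0_INR | apply le_INR; lia].
Qed.

Lemma bounded_seq_cluster (x : nat -> R) (M : R) : (forall n, Rabs (x n) <= M) ->
  exists l, forall eps N, 0 < eps -> exists n, (N <= n)%nat /\ Rabs (x n - l) < eps.
Proof.
  intros HM.
  destruct (Bolzano_Weierstrass x (fun c => - M <= c <= M)) as [l Hl].
  - apply compact_P3.
  - intros n; specialize (HM n); now apply Rabs_le_between.
  - exists l; intros eps N He.
    destruct (Hl (fun y => Rabs (y - l) < eps) N) as (n & H1 & H2); [| now exists n].
    exists (mkposreal eps He); intros y Hy; exact Hy.
Qed.

Definition cluster (s : nat -> pt) (l : pt) : Prop :=
  forall eps N, 0 < eps -> exists n, (N <= n)%nat /\ dist2 (s n) l < eps.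

Lemma bounded_cluster (s : nat -> pt) (M : R) :
  (forall n, dist2 (s n) (0, 0) <= M) -> exists l, cluster s l.
Proof.
  intros HM.
  assert (HM' : forall n, Rabs (fst (s n)) <= M /\ Rabs (snd (s n)) <= M).
  { intros n; specialize (HM n); destruct (abs_le_dist2 (s n) (0, 0)) as [H1 H2].
    simpl in H1, H2; rewrite Rminus_0_r in H1, H2; lra. }
  destruct (bounded_seq_cluster (fun n => fst (s n)) M) as [lx Hx]; [intros; apply HM' |].
  destruct (functional_choice (fun k n => (k <= n)%nat /\ Rabs (fst (s n) - lx) < / INR (S k)))
    as [f Hf].
  { intros k; apply Hx, inv_INR_S_pos. }
  destruct (bounded_seq_cluster (fun k => snd (s (f k))) M) as [ly Hy]; [intros; apply HM' |].
  exists (lx, ly); intros eps N He.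
  destruct (inv_INR_S_small (eps / 2)) as [N1 HN1]; [lra |].
  destruct (Hy (eps / 2) (max N N1)) as (k & Hk & Hky); [lra |].
  destruct (Hf k) as [H1 H2]; exists (f k); split; [lia |].
  pose proof (dist2_le_abs (s (f k)) (lx, ly)) as H; simpl in H.
  specialize (HN1 k); specialize (HN1 ltac:(lia)); lra.
Qed.

Lemma compact_cluster (K : pt -> Prop) (s : nat -> pt) :
  closed2 K -> bounded2 K -> (forall n, K (s n)) -> exists l, K l /\ cluster s l.
Proof.
  intros Hc [M HM] Hs.
  destruct (bounded_cluster s M) as [l Hl]; [intros n; apply HM, Hs |].
  exists l; split; [| exact Hl]. apply Hc; intros eps He.
  destruct (Hl eps 0%nat He) as (n & _ & Hn). exists (s n); rewrite dist2_sym; auto.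
Qed.

(** A cluster point of a maximizing sequence attains the supremum; continuity enters as a Lipschitz
    bound with constant 1. *)
Lemma compact_max (K : pt -> Prop) (g : pt -> R) :
  closed2 K -> bounded2 K -> (exists p, K p) ->
  (forall p q, K p -> K q -> g p <= g q + dist2 p q) ->
  exists p, K p /\ forall q, K q -> g q <= g p.
Proof.
  intros Hc Hb [p0 Hp0] Hg. pose proof Hb as [M HM].
  destruct (completeness (fun y => exists p, K p /\ y = g p)) as [b [Hub Hl]].
  { exists (g p0 + (M + M)); intros y (p & Hp & ->).
    pose proof (Hg p p0 Hp Hp0); pose proof (dist2_triangle p (0, 0) p0).
    pose proof (HM p Hp); pose proof (HM p0 Hp0); rewrite (dist2_sym (0,0)) in *; lra. }
  { exists (g p0); now exists p0. }
  destruct (functional_choice (fun n p => K p /\ b - / INR (S n) < g p)) as [s Hs].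
  { intros n; apply NNPP; intros H.
    assert (b <= b - / INR (S n)); [| pose proof (inv_INR_S_pos n); lra].
    apply Hl; intros y (p & Hp & ->). apply Rnot_lt_le; intros Hlt; apply H; now exists p. }
  destruct (compact_cluster K s Hc Hb) as (l & Kl & Hcl); [intros n; apply Hs |].
  exists l; split; [exact Kl |].
  assert (Hbl : b <= g l).
  { apply le_epsilon; intros eps He.
    destruct (inv_INR_S_small (eps / 2)) as [N HN]; [lra |].
    destruct (Hcl (eps / 2) N) as (n & Hn & Hd); [lra |].
    destruct (Hs n) as [K1 K2]. pose proof (Hg (s n) l K1 Kl). pose proof (HN n Hn). lra. }
  intros q Kq; apply Rle_trans with b; [| exact Hbl]. apply Hub; now exists q.
Qed.

(** Two successive maximizations: the distance from [p] to its farthest point [f p] is again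
    Lipschitz with constant 1 in [p]. *)
Lemma farthest_pair (G : pt -> Prop) :
  closed2 G -> bounded2 G -> (exists p, G p) ->
  exists p q, G p /\ G q /\ forall p' q', G p' -> G q' -> dist2 p' q' <= dist2 p q.
Proof.
  intros Hc Hb Hne.
  destruct (functional_choice
    (fun p q => G p -> G q /\ forall q', G q' -> dist2 p q' <= dist2 p q)) as [f Hf].
  { intros p; destruct (compact_max G (dist2 p) Hc Hb Hne) as (q & H); [| now exists q].
    intros a b _ _; rewrite (dist2_sym a b); apply dist2_triangle. }
  destruct (compact_max G (fun p => dist2 p (f p)) Hc Hb Hne) as (p & Gp & Hp).
  { intros a b Ga Gb. destruct (Hf a Ga) as [Gfa _].
    pose proof (proj2 (Hf b Gb) (f a) Gfa). pose proof (dist2_triangle a b (f a)). lra. }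
  exists p, (f p); repeat split; [exact Gp | now apply Hf |].
  intros p' q' Gp' Gq'. apply Rle_trans with (dist2 p' (f p')); [now apply Hf | now apply Hp].
Qed.

(** * Incircle and circumcircle *)

Section Body.

Variable K : pt -> Prop.
Hypotheses (Hclosed : closed2 K) (Hbounded : bounded2 K) (Hint : has_interior2 K).

Lemma body_inhabited : exists p, K p.
Proof.
  destruct Hint as (c & rho & H1 & H2). exists c; apply H2; now rewrite dist2_refl.
Qed.

Lemma dist2_le_diameter p q : K p -> K q -> dist2 p q <= diameter K.
Proof.
  intros Kp Kq; destruct Hbounded as [M HM].
  destruct (lub_real (fun d => exists p q, K p /\ K q /\ d = dist2 p q) (M + M)) as [H _].
  - exists (dist2 p q), p, q; auto.
  - intros d (a & b & Ka & Kb & ->). pose proof (dist2_triangle a (0, 0) b).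
    rewrite (dist2_sym (0, 0)) in *. pose proof (HM a Ka); pose proof (HM b Kb); lra.
  - apply H; exists p, q; auto.
Qed.

Lemma dot_le_support u p : fst u ^ 2 + snd u ^ 2 = 1 -> K p -> dot2 p u <= support K u.
Proof.
  intros Hu Kp; destruct Hbounded as [M HM].
  destruct (lub_real (fun s => exists x, K x /\ s = dot2 x u) (M + 1)) as [H _].
  - exists (dot2 p u), p; auto.
  - intros s (x & Kx & ->). unfold dot2. pose proof (HM x Kx) as Hx.
    pose proof (dist2_sq x (0, 0)) as E; simpl fst in E; simpl snd in E.
    pose proof (dist2_pos x (0, 0)).
    pose proof (pow2_ge_0 (fst x * snd u - snd x * fst u)).
    assert ((fst x * fst u + snd x * snd u) ^ 2 <= dist2 x (0, 0) ^ 2).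
    { rewrite E. replace ((fst x - 0) ^ 2 + (snd x - 0) ^ 2) with
      ((fst x ^ 2 + snd x ^ 2) * (fst u ^ 2 + snd u ^ 2)) by (rewrite Hu; ring). lra. }
    nra.
  - apply H; exists p; auto.
Qed.

(** The supremum is attained: centers of inscribed discs with radii tending to [r] cluster at a
    point [c], and closedness of [K] puts the whole disc of radius [r] about [c] into [K]. *)
Lemma incircle : 0 < inradius K /\
  exists c, forall p, dist2 p c <= inradius K -> K p.
Proof.
  pose proof Hbounded as [M HM].
  destruct (lub_real (fun rho => 0 <= rho /\ exists c, forall p, dist2 p c <= rho -> K p) (M + M))
    as [Hub Hl].
  - destruct Hint as (c & rho & H1 & H2). exists (rho / 2); split; [lra |].
    exists c; intros p Hp; apply H2; lra.
  - intros rho (H0 & c & Hc).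
    assert (K1 : K (fst c + rho, snd c)) by (apply Hc, dist2_le; simpl; lra).
    assert (K2 : K (fst c - rho, snd c)) by (apply Hc, dist2_le; simpl; lra).
    destruct (abs_le_dist2 (fst c + rho, snd c) (fst c - rho, snd c)) as [H _]; simpl in H.
    pose proof (dist2_triangle (fst c + rho, snd c) (0, 0) (fst c - rho, snd c)) as Ht.
    rewrite (dist2_sym (0, 0)) in Ht. pose proof (HM _ K1); pose proof (HM _ K2).
    pose proof (Rle_abs (fst c + rho - (fst c - rho))). lra.
  - fold (inradius K) in Hub, Hl. set (r := inradius K) in *.
    assert (Hr : 0 < r).
    { destruct Hint as (c & rho & H1 & H2).
      apply Rlt_le_trans with (rho / 2); [lra |]. apply Hub; split; [lra |].
      exists c; intros p Hp; apply H2; lra. }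
    split; [exact Hr |].
    destruct (functional_choice (fun n c => exists rho, r - / INR (S n) < rho /\ 0 <= rho <= r /\
      forall p, dist2 p c <= rho -> K p)) as [s Hs].
    { intros n; apply NNPP; intros H.
      assert (r <= r - / INR (S n)); [| pose proof (inv_INR_S_pos n); lra].
      apply Hl; intros rho (H0 & c & Hc). apply Rnot_lt_le; intros Hlt; apply H.
      exists c, rho; repeat split; auto. apply Hub; split; [exact H0 | now exists c]. }
    destruct (compact_cluster K s Hclosed Hbounded) as (c & Kc & Hcl).
    { intros n; destruct (Hs n) as (rho & _ & [H0 _] & H). apply H; now rewrite dist2_refl. }
    exists c; intros p Hp; apply Hclosed; intros eps He.
    destruct (inv_INR_S_small (eps / 2)) as [N HN]; [lra |].
    destruct (Hcl (eps / 2) N) as (n & Hn & Hd); [lra |].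
    destruct (Hs n) as (rho & H1 & H2 & H3). specialize (HN n Hn).
    (* Scaling by [t] and translating [c] to [s n] carries the disc of radius [r] about [c] into the
       inscribed disc about [s n]. This moves [p] by at most [(1 - t) r = r - rho] plus the distance
       between the centers. *)
    set (t := rho / r).
    assert (Ht : t * r = rho) by (unfold t; field; lra).
    assert (Ht0 : 0 <= t <= 1) by (split; nra).
    set (q := (fst (s n) + t * (fst p - fst c), snd (s n) + t * (snd p - snd c))).
    pose proof (dist2_sq p c) as E. pose proof (dist2_pos p c).
    exists q; split.
    + apply H3, dist2_le; [lra |]. simpl fst; simpl snd.
      transitivity ((t * dist2 p c) ^ 2); [rewrite Rpow_mult_distr, E; lra | apply pow_incr; nra].
    + set (q' := (fst c + t * (fst p - fst c), snd c + t * (snd p - snd c))).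
      pose proof (dist2_triangle p q' q).
      assert (dist2 q' q < eps / 2).
      { replace (dist2 q' q) with (dist2 (s n) c); [exact Hd |].
        unfold dist2, q, q'; simpl fst; simpl snd; f_equal; ring. }
      assert (dist2 p q' <= (1 - t) * r).
      { apply dist2_le; [nra |]. unfold q'; simpl fst; simpl snd.
        transitivity (((1 - t) * dist2 p c) ^ 2); [rewrite Rpow_mult_distr, E; lra | apply pow_incr; nra]. }
      lra.
Qed.

Lemma circumcircle :
  exists o, (forall p, K p -> dist2 p o <= circumradius K) /\
    forall rho c, 0 <= rho -> (forall p, K p -> dist2 p c <= rho) -> circumradius K <= rho.
Proof.
  pose proof Hbounded as [M HM]. destruct body_inhabited as [p0 Kp0].
  destruct (glb_real (fun rho => 0 <= rho /\ exists c, forall p, K p -> dist2 p c <= rho) 0)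
    as [Hlb Hg].
  - exists M; split; [| now exists (0, 0)].
    pose proof (HM p0 Kp0); pose proof (dist2_pos p0 (0, 0)); lra.
  - intros x [H _]; exact H.
  - fold (circumradius K) in Hlb, Hg. set (Rc := circumradius K) in *.
    destruct (functional_choice (fun n c => forall p, K p -> dist2 p c <= Rc + / INR (S n)))
      as [s Hs].
    { intros n; apply NNPP; intros H.
      assert (Rc + / INR (S n) <= Rc); [| pose proof (inv_INR_S_pos n); lra].
      apply Hg; intros rho (H0 & c & Hc). apply Rnot_lt_le; intros Hlt; apply H.
      exists c; intros p Kp; specialize (Hc p Kp); lra. }
    destruct (bounded_cluster s (Rc + 1 + M)) as [o Ho].
    { intros n. pose proof (Hs n p0 Kp0). pose proof (HM p0 Kp0).
      pose proof (dist2_triangle (s n) p0 (0, 0)). rewrite (dist2_sym (s n) p0) in *.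
      assert (/ INR (S n) <= 1); [| lra].
      rewrite <- Rinv_1. apply Rinv_le_contravar; [lra |]. rewrite S_INR. pose proof (pos_INR n); lra. }
    exists o; split.
    + intros p Kp; apply le_epsilon; intros eps He.
      destruct (inv_INR_S_small (eps / 2)) as [N HN]; [lra |].
      destruct (Ho (eps / 2) N) as (n & Hn & Hd); [lra |].
      pose proof (Hs n p Kp); pose proof (HN n Hn); pose proof (dist2_triangle p (s n) o). lra.
    + intros rho c H0 H; apply Hlb; split; [exact H0 | now exists c].
Qed.

(* Otherwise moving the center slightly along [v] would give a smaller enclosing disc. *)
Lemma contact_in_half_plane (o v : pt) (Rc : R) :
  (forall p, K p -> dist2 p o <= Rc) ->
  (forall rho c, 0 <= rho -> (forall p, K p -> dist2 p c <= rho) -> Rc <= rho) ->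
  exists p, K p /\ dist2 p o = Rc /\
    (fst p - fst o) * fst v + (snd p - snd o) * snd v <= 0.
Proof.
  intros Ho Hmin.
  (* Each moved center [on n] has some point of [K] at distance at least [Rc], by minimality. A
     cluster point of these points is the required contact point. *)
  set (on := fun n => (fst o + / INR (S n) * fst v, snd o + / INR (S n) * snd v)).
  destruct (functional_choice (fun n p => K p /\ Rc <= dist2 p (on n))) as [s Hs].
  { intros n.
    destruct (compact_max K (fun p => dist2 p (on n)) Hclosed Hbounded body_inhabited)
      as (p & Kp & Hp).
    - intros p q _ _. pose proof (dist2_triangle p q (on n)); lra.
    - exists p; split; [exact Kp |]. now apply (Hmin _ (on n)); [apply dist2_pos |]. }
  destruct (compact_cluster K s Hclosed Hbounded) as (p & Kp & Hcl); [intros; apply Hs |].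
  exists p; split; [exact Kp |].
  assert (HR0 : 0 <= Rc) by (pose proof (Ho p Kp); pose proof (dist2_pos p o); lra).
  set (V := Rabs (fst v) + Rabs (snd v)).
  pose proof (Rabs_pos (fst v)); pose proof (Rabs_pos (snd v)).
  assert (Hon : forall n, dist2 (on n) o <= / INR (S n) * V).
  { intros n; pose proof (dist2_le_abs (on n) o) as H1; unfold on in *; cbn [fst snd] in H1.
    pose proof (inv_INR_S_pos n).
    replace (fst o + / INR (S n) * fst v - fst o) with (/ INR (S n) * fst v) in H1 by ring.
    replace (snd o + / INR (S n) * snd v - snd o) with (/ INR (S n) * snd v) in H1 by ring.
    rewrite !Rabs_mult, (Rabs_pos_eq (/ INR (S n))) in H1 by lra. unfold V, on; lra. }
  split.
  - apply Rle_antisym; [now apply Ho |].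
    apply le_epsilon; intros eps He.
    destruct (inv_INR_S_small (eps / 2 / (V + 1))) as [N HN].
    { apply Rdiv_lt_0_compat; unfold V; lra. }
    destruct (Hcl (eps / 2) N) as (n & Hn & Hd); [lra |].
    pose proof (HN n Hn) as H1. destruct (Hs n) as [_ H2]. pose proof (Hon n) as H3.
    pose proof (dist2_triangle (s n) p (on n)). pose proof (dist2_triangle p o (on n)).
    rewrite (dist2_sym o (on n)) in *.
    assert (/ INR (S n) * V < eps / 2); [| lra].
    apply Rle_lt_trans with (/ INR (S n) * (V + 1)).
    { pose proof (inv_INR_S_pos n); lra. }
    replace (eps / 2) with (eps / 2 / (V + 1) * (V + 1)) by (field; unfold V; lra).
    apply Rmult_lt_compat_r; [unfold V; lra | exact H1].
  - apply le_epsilon; intros eps He.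
    destruct (inv_INR_S_small (eps / 2 / (V * V + 1))) as [N HN].
    { apply Rdiv_lt_0_compat; [lra | nra]. }
    destruct (Hcl (eps / 2 / (V + 1)) N) as (n & Hn & Hd).
    { apply Rdiv_lt_0_compat; unfold V; lra. }
    pose proof (HN n Hn) as H1. destruct (Hs n) as [Ks H2].
    pose proof (Ho _ Ks) as H3. pose proof (inv_INR_S_pos n) as H4.
    set (t := / INR (S n)) in *.
    (* The point [s n] is within [Rc] of [o] but not nearer than [Rc] to [o + t v]; expanding the
       squares bounds its component along [v] by a multiple of [t]. *)
    assert (Hdot : (fst (s n) - fst o) * fst v + (snd (s n) - snd o) * snd v <= t * (V * V)).
    { assert (Rc ^ 2 <= dist2 (s n) (on n) ^ 2) by (apply pow_incr; lra).
      assert (dist2 (s n) o ^ 2 <= Rc ^ 2) by (apply pow_incr; pose proof (dist2_pos (s n) o); lra).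
      rewrite dist2_sq in *. unfold on in *; cbn [fst snd] in *. fold t in H5.
      apply (Rmult_le_reg_l (2 * t)); [lra |].
      assert (fst v ^ 2 + snd v ^ 2 <= V * V).
      { rewrite <- (pow2_abs (fst v)), <- (pow2_abs (snd v)). unfold V; nra. }
      nra. }
    destruct (abs_le_dist2 (s n) p) as [A1 A2].
    assert ((fst p - fst (s n)) * fst v + (snd p - snd (s n)) * snd v <= eps / 2).
    { apply Rle_trans with (dist2 (s n) p * V).
      - unfold V. rewrite Rmult_plus_distr_l. apply Rplus_le_compat.
        + eapply Rle_trans; [apply Rle_abs |]. rewrite Rabs_mult, Rabs_minus_sym.
          apply Rmult_le_compat_r; [apply Rabs_pos | exact A1].
        + eapply Rle_trans; [apply Rle_abs |]. rewrite Rabs_mult, Rabs_minus_sym.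
          apply Rmult_le_compat_r; [apply Rabs_pos | exact A2].
      - apply Rle_trans with (eps / 2 / (V + 1) * (V + 1)).
        + apply Rmult_le_compat; unfold V in *; try lra. apply dist2_pos.
        + right; field; unfold V; lra. }
    assert (t * (V * V) <= eps / 2).
    { apply Rle_trans with (eps / 2 / (V * V + 1) * (V * V + 1)).
      - apply Rmult_le_compat; try lra; nra.
      - right; field; nra. }
    lra.
Qed.

End Body.

(** * The inscribed triangle of contact points *)

Lemma closed2_contact (K : pt -> Prop) (o : pt) (Rc : R) :
  closed2 K -> closed2 (fun p => K p /\ dist2 p o = Rc).
Proof.
  intros Hc p Hp; split.
  - apply Hc; intros eps He; destruct (Hp eps He) as (q & [Kq _] & Hq); now exists q.
  - apply Rle_antisym; apply le_epsilon; intros eps He;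
      destruct (Hp eps He) as (q & [_ Eq] & Hq);
      pose proof (dist2_triangle p q o); pose proof (dist2_triangle q p o);
      rewrite (dist2_sym q p) in *; lra.
Qed.

(* The endpoints [p], [q] of a longest chord of the contact set, and a contact
   point [s] on the other side of the center. *)
Lemma circumscribed_nonobtuse_triangle (K : pt -> Prop) (o : pt) (D Rc : R) :
  closed2 K -> bounded2 K -> has_interior2 K ->
  (forall p q, K p -> K q -> dist2 p q <= D) ->
  (forall p, K p -> dist2 p o <= Rc) ->
  (forall rho c, 0 <= rho -> (forall p, K p -> dist2 p c <= rho) -> Rc <= rho) ->
  0 < Rc -> D < 2 * Rc ->
  exists p q s, (K p /\ dist2 p o = Rc) /\ (K q /\ dist2 q o = Rc) /\ (K s /\ dist2 s o = Rc) /\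
    corner D p q s /\ corner D q s p /\ corner D s p q.
Proof.
  intros Hc Hb Hi HD Ho Hmin HR HDR.
  destruct (farthest_pair (fun p => K p /\ dist2 p o = Rc)) as (p & q & Gp & Gq & Hfar).
  - now apply closed2_contact.
  - destruct Hb as [M HM]; exists M; intros p [Kp _]; now apply HM.
  - destruct (contact_in_half_plane K Hc Hb Hi o (0, 0) Rc Ho Hmin) as (p & Kp & Ep & _).
    now exists p.
  (* The direction is the sum of [p - o] and [q - o]. It makes the angle at [s] non-obtuse; those at
     [p] and [q] are non-obtuse because [p q] is a longest side. *)
  - destruct (contact_in_half_plane K Hc Hb Hi o
      (fst p - fst o + (fst q - fst o), snd p - snd o + (snd q - snd o)) Rc Ho Hmin)
      as (s & Ks & Es & Hs); simpl fst in Hs; simpl snd in Hs.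
    exists p, q, s; split; [exact Gp |]; split; [exact Gq |]; split; [now split |].
    destruct Gp as [Kp Ep], Gq as [Kq Eq].
    assert (F : forall a b, K a -> K b -> dist2 a b ^ 2 <= D ^ 2).
    { intros a b Ka Kb; apply pow_incr; split; [apply dist2_pos | now apply HD]. }
    assert (F1 := F p q Kp Kq). assert (F2 := F q s Kq Ks). assert (F3 := F s p Ks Kp).
    assert (G1 : dist2 q s ^ 2 <= dist2 p q ^ 2).
    { apply pow_incr; split; [apply dist2_pos | now apply Hfar]. }
    assert (G2 : dist2 s p ^ 2 <= dist2 p q ^ 2).
    { apply pow_incr; split; [apply dist2_pos | now apply Hfar]. }
    assert (D0 : 0 <= D) by (pose proof (HD p p Kp Kp) as X; rewrite dist2_refl in X; exact X).
    assert (DR : D ^ 2 < (2 * Rc) ^ 2) by nra.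
    assert (Ep2 : dist2 p o ^ 2 = Rc ^ 2) by now rewrite Ep.
    assert (Eq2 : dist2 q o ^ 2 = Rc ^ 2) by now rewrite Eq.
    assert (Es2 : dist2 s o ^ 2 = Rc ^ 2) by now rewrite Es.
    unfold corner, dotat; rewrite !dist2_sq in *.
    destruct p as [p1 p2], q as [q1 q2], s as [s1 s2], o as [o1 o2]; simpl fst in *; simpl snd in *.
    pose proof (pow2_ge_0 (p1 - s1)); pose proof (pow2_ge_0 (p2 - s2)).
    pose proof (pow2_ge_0 (q1 - s1)); pose proof (pow2_ge_0 (q2 - s2)).
    pose proof (pow2_ge_0 (p1 - q1)); pose proof (pow2_ge_0 (p2 - q2)).
    assert (HR2 : 0 < Rc ^ 2) by nra.
    (* If [s] were [q] or [p], its product with the chosen direction would be [2 Rc^2] minus half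
       the square of the chord [p q], which is positive since [D < 2 Rc]. *)
    assert (N1 : 0 < (q1 - s1) ^ 2 + (q2 - s2) ^ 2).
    { apply Rnot_le_lt; intros N. assert (q1 = s1) by nra. assert (q2 = s2) by nra. subst; lra. }
    assert (N2 : 0 < (s1 - p1) ^ 2 + (s2 - p2) ^ 2).
    { apply Rnot_le_lt; intros N. assert (p1 = s1) by nra. assert (p2 = s2) by nra. subst; lra. }
    repeat split; lra.
Qed.

Theorem theorem3p2 (K : pt -> Prop) :
  convex_body2 K ->
  let r := inradius K in
  let w := width K in
  let D := diameter K in
  let Rc := circumradius K in
  w >= 2 * D * sqrt (1 - (D / (2 * Rc)) ^ 2) *
       cos (acos (D / (2 * (D - r))) + acos (D / (2 * Rc)) - asin (r / (D - r))).
Proof.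
  intros (_ & Hc & Hb & Hi) r w D Rc.
  destruct (incircle K Hc Hb Hi) as (Hr & c & Hball); fold r in Hr, Hball.
  destruct (circumcircle K Hb Hi) as (o & Ho & Hmin); fold Rc in Ho, Hmin.
  assert (HD : forall p q, K p -> K q -> dist2 p q <= D) by (now apply dist2_le_diameter).
  assert (Hru : forall u t, fst u ^ 2 + snd u ^ 2 = 1 -> Rabs t <= r ->
     K (fst c + t * fst u, snd c + t * snd u)).
  { intros u t Hu Ht; apply Hball, dist2_le; [lra |]; simpl fst; simpl snd.
    replace ((fst c + t * fst u - fst c) ^ 2 + (snd c + t * snd u - snd c) ^ 2)
      with (t ^ 2 * (fst u ^ 2 + snd u ^ 2)) by ring.
    rewrite Hu, Rmult_1_r, <- pow2_abs. apply pow_incr; split; [apply Rabs_pos | exact Ht]. }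
  assert (Kc : K c) by (apply Hball; rewrite dist2_refl; lra).
  assert (Hrho : forall p, K p -> dist2 p c <= D - r).
  { intros p Kp. pose proof (dist2_pos p c) as [Hpc | Hpc].
    - set (d := dist2 p c) in *.
      set (u := ((fst c - fst p) / d, (snd c - snd p) / d)).
      assert (Hu : fst u ^ 2 + snd u ^ 2 = 1).
      { unfold u; simpl fst; simpl snd.
        replace (((fst c - fst p) / d) ^ 2 + ((snd c - snd p) / d) ^ 2)
          with (((fst p - fst c) ^ 2 + (snd p - snd c) ^ 2) / d ^ 2) by (field; lra).
        rewrite <- dist2_sq. fold d. field; lra. }
      pose proof (HD p _ Kp (Hru u r Hu ltac:(rewrite Rabs_pos_eq; lra))) as H.
      assert (E : dist2 p (fst c + r * fst u, snd c + r * snd u) ^ 2 = (d + r) ^ 2).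
      { rewrite dist2_sq; simpl fst; simpl snd.
        transitivity (d ^ 2 * (fst u ^ 2 + snd u ^ 2) + 2 * r * d * (fst u ^ 2 + snd u ^ 2)
           + r ^ 2 * (fst u ^ 2 + snd u ^ 2)); [| rewrite Hu; ring].
        unfold u; simpl fst; simpl snd; field; lra. }
      pose proof (dist2_pos p (fst c + r * fst u, snd c + r * snd u)). nra.
    - pose proof (HD p _ Kp (Hru (1, 0) r ltac:(simpl; ring) ltac:(rewrite Rabs_pos_eq; lra))) as H.
      destruct (abs_le_dist2 c (fst c + r * 1, snd c + r * 0)) as [H1 _].
      pose proof (dist2_triangle c p (fst c + r * 1, snd c + r * 0)) as H2.
      simpl fst in *; simpl snd in *. rewrite (dist2_sym c p) in H2.
      rewrite Rabs_minus_sym in H1. pose proof (Rle_abs (fst c + r * 1 - fst c)). lra. }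
  (* Equivalently [2 r <= D]; this keeps the arguments [D / (2 (D - r))] and [r / (D - r)] in the
     range where [acos] and [asin] are genuine inverses. *)
  assert (Hrr : r <= D - r).
  { pose proof (Hrho _ (Hru (1, 0) r ltac:(simpl; ring) ltac:(rewrite Rabs_pos_eq; lra))) as H.
    destruct (abs_le_dist2 (fst c + r * fst (1, 0), snd c + r * snd (1, 0)) c) as [H1 _].
    cbn [fst snd] in *.
    pose proof (Rle_abs (fst c + r * 1 - fst c)). lra. }
  assert (HD2 : D <= 2 * Rc).
  { destruct (Rle_dec D (2 * Rc)) as [| N]; [assumption | exfalso].
    assert (D <= 2 * Rc); [| lra].
    apply (lub_real (fun d => exists p q, K p /\ K q /\ d = dist2 p q) (2 * Rc)).
    - exists (dist2 c c), c, c; auto.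
    - intros d (p & q & Kp & Kq & ->). pose proof (dist2_triangle p o q).
      rewrite (dist2_sym o q) in *. pose proof (Ho p Kp); pose proof (Ho q Kq); lra.
    - intros d (p & q & Kp & Kq & ->). pose proof (dist2_triangle p o q).
      rewrite (dist2_sym o q) in *. pose proof (Ho p Kp); pose proof (Ho q Kq); lra. }
  assert (HR : 0 < Rc) by lra.
  assert (Hw : forall b, (forall u, fst u ^ 2 + snd u ^ 2 = 1 ->
     b <= support K u + support K (- fst u, - snd u)) -> b <= w).
  { intros b H. unfold w, width.
    eapply (glb_real (fun w => exists u : pt, fst u ^ 2 + snd u ^ 2 = 1 /\
          w = support K u + support K (- fst u, - snd u)) b).
    - exists (support K (1, 0) + support K (- fst (1, 0), - snd (1, 0))), (1, 0).
      split; [simpl; ring | reflexivity].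
    - intros x (u & Hu & ->); now apply H.
    - intros x (u & Hu & ->); now apply H. }
  apply Rle_ge. change (width_bound r D Rc <= w). apply Hw; intros u Hu.
  set (M := support K u). set (m := - support K (- fst u, - snd u)).
  assert (HM : forall p, K p -> m <= dot2 p u <= M).
  { intros p Kp; split; [| now apply dot_le_support].
    assert (dot2 p (- fst u, - snd u) <= - m).
    { unfold m; rewrite Ropp_involutive; apply dot_le_support; auto. simpl fst; simpl snd; lra. }
    unfold dot2 in *; simpl fst in *; simpl snd in *; lra. }
  replace (M + _) with (M - m) by (unfold m; ring).
  destruct (Rle_lt_or_eq_dec _ _ HD2) as [HDR | HDR].
  (* If [D = 2 Rc], the square root vanishes and the bound is 0. *)
  2: { pose proof (HM c Kc).
       unfold width_bound. replace (D / (2 * Rc)) with 1 by (rewrite HDR; field; lra).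
       replace (1 - 1 ^ 2) with 0 by ring. rewrite sqrt_0. lra. }
  (* Some contact point lies on the side of [o] away from the incenter [c], so its distance to [c]
     is at least [Rc]. *)
  assert (HRrho : Rc <= D - r).
  { destruct (contact_in_half_plane K Hc Hb Hi o (fst c - fst o, snd c - snd o) Rc Ho Hmin)
      as (p & Kp & Ep & Hp); simpl fst in Hp; simpl snd in Hp.
    apply Rle_trans with (2 := Hrho p Kp).
    assert (dist2 p o ^ 2 <= dist2 p c ^ 2).
    { rewrite !dist2_sq.
      pose proof (pow2_ge_0 (fst c - fst o)); pose proof (pow2_ge_0 (snd c - snd o)). lra. }
    rewrite Ep in H. pose proof (dist2_pos p c). nra. }
  destruct (circumscribed_nonobtuse_triangle K o D Rc Hc Hb Hi HD Ho Hmin HR HDR)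
    as (p & q & s & [Kp Ep] & [Kq Eq] & [Ks Es] & C1 & C2 & C3).
  (* The rotation taking [u] to the vertical direction, so that the supporting strip becomes
     horizontal. *)
  set (f := fun x : pt => (fst x * snd u - snd x * fst u, dot2 x u)).
  assert (Hdot : forall a b d, dotat (f a) (f b) (f d) = dotat a b d).
  { intros a b d. transitivity (dotat a b d * (fst u ^ 2 + snd u ^ 2)); [| rewrite Hu; ring].
    unfold dotat, f, dot2; simpl fst; simpl snd; ring. }
  assert (Hdist : forall a b, dist2 (f a) (f b) ^ 2 = dist2 a b ^ 2).
  { intros a b. transitivity (dist2 a b ^ 2 * (fst u ^ 2 + snd u ^ 2)); [| rewrite Hu; ring].
    rewrite !dist2_sq. unfold f, dot2; simpl fst; simpl snd; ring. }
  assert (V : forall x, K x -> dist2 x o = Rc -> vertex Rc (D - r) m M (f o) (f c) (f x)).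
  { intros x Kx Ex; unfold vertex; rewrite !Hdist, Ex; repeat split; try (now apply HM).
    apply pow_incr; split; [apply dist2_pos | now apply Hrho]. }
  apply (width_bound_le_strip Rc D r HR (Rlt_le _ _ Hr) HRrho HDR ltac:(lra) m M (f o) (f c) (f p) (f q) (f s)).
  - unfold strip_config, corner in *; rewrite !Hdot, !Hdist; auto 10.
  - pose proof (HM _ (Hru u (- r) Hu ltac:(rewrite Rabs_Ropp, Rabs_pos_eq; lra))) as H.
    unfold f; simpl snd. unfold dot2 in *; simpl fst in H; simpl snd in H.
    assert (r * (fst u ^ 2 + snd u ^ 2) = r) by (rewrite Hu; ring). lra.
  - pose proof (HM _ (Hru u r Hu ltac:(rewrite Rabs_pos_eq; lra))) as H.
    unfold f; simpl snd. unfold dot2 in *; simpl fst in H; simpl snd in H.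
    assert (r * (fst u ^ 2 + snd u ^ 2) = r) by (rewrite Hu; ring). lra.
Qed.
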